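(* Let $\Phi=(A;\{E_i\}_{i=0}^d;A^*;\{E^*_i\}_{i=0}^d)$ be a tridiagonal system on $V$ with $d\ge1$, and let $R$ and $L$ be the $\Phi$-raising and $\Phi$-lowering maps. For $0\le i\le j\le d$ the following hold. (i) The map $R^{j-i}:E^*_iV\to E^*_jV$ is injective if $i+j\le d$, bijective if $i+j=d$, and surjective if $i+j\ge d$. (ii) The map $L^{j-i}:E^*_jV\to E^*_iV$ is injective if $i+j\ge d$, bijective if $i+j=d$, and surjective if $i+j\le d$.
   Context: Let $\mathbb F$ be a field and $V$ a nonzero finite-dimensional vector space over $\mathbb F$; $\mathrm{End}(V)$ is the algebra of $\mathbb F$-linear maps $V\to V$, with identity $I$. A tridiagonal pair on $V$ is an ordered pair $A,A^*\in\mathrm{End}(V)$ such that: (1) each of $A,A^*$ is diagonalizable; (2) there is an ordering $\{V_i\}_{i=0}^d$ of the eigenspaces of $A$ with $A^*V_i\subseteq V_{i-1}+V_i+V_{i+1}$ $(0\le i\le d)$, where $V_{-1}=V_{d+1}=0$; (3) there is an ordering $\{V^*_i\}_{i=0}^\delta$ of the eigenspaces of $A^*$ with $AV^*_i\subseteq V^*_{i-1}+V^*_i+V^*_{i+1}$ $(0\le i\le\delta)$, where $V^*_{-1}=V^*_{\delta+1}=0$; (4) there is no subspace $W\subseteq V$ with $W\ne0$, $W\ne V$, $AW\subseteq W$, $A^*W\subseteq W$. It is known that $d=\delta$. Orderings as in (2), (3) are called standard. For a diagonalizable map, the primitive idempotent attached to an eigenspace is the projection onto that eigenspace that vanishes on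 the other eigenspaces; an ordering of primitive idempotents is standard if the corresponding ordering of eigenspaces is. A tridiagonal system on $V$ is a sequence $\Phi=(A;\{E_i\}_{i=0}^d;A^*;\{E^*_i\}_{i=0}^d)$ where $A,A^*$ is a tridiagonal pair on $V$, $\{E_i\}$ is a standard ordering of the primitive idempotents of $A$, and $\{E^*_i\}$ is a standard ordering of the primitive idempotents of $A^*$. Throughout $d\ge1$. Define $R=\sum_{i=0}^{d-1}E^*_{i+1}AE^*_i$ and $L=\sum_{i=1}^dE^*_{i-1}AE^*_i$ (the $\Phi$-raising and $\Phi$-lowering maps). By construction $RE^*_iV\subseteq E^*_{i+1}V$ for $0\le i\le d-1$ and $RE^*_dV=0$; also $LE^*_iV\subseteq E^*_{i-1}V$ for $1\le i\le d$ and $LE^*_0V=0$. *)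

(* Defs.v *)
From mathcomp Require Import all_boot all_algebra.

Set Implicit Arguments.
Unset Strict Implicit.
Unset Printing Implicit Defensive.

Import GRing.Theory.
Local Open Scope ring_scope.

Section Tridiagonal.

Variables (F : fieldType) (V : vectType F).
Implicit Types (A B : 'End(V)) (U W : {vspace V}).

Definition lfun_diagonalizable A : Prop :=
  exists2 X : seq V, basis_of fullv X &
    {in X, forall v, exists a : F, A v = a *: v}.

Definition is_eigenspace A W : Prop :=
  exists2 a : F, passmx.leigenvalue A a & W = passmx.leigenspace A a.

Definition eigenspace_ordering (d : nat) A (U : 'I_d.+1 -> {vspace V}) : Prop :=
  injective U /\ forall W, is_eigenspace A W <-> exists i, W = U i.

(* The sum ranges over the j with |i - j| <= 1, so that the spaces U_(-1) and
   U_(d+1), which are 0 by convention, contribute nothing. *)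
Definition standard_ordering (d : nat) A B (U : 'I_d.+1 -> {vspace V}) : Prop :=
  eigenspace_ordering A U /\
  forall i : 'I_d.+1,
    (B @: U i <= \sum_(j < d.+1 | (i <= j.+1)%N && (j <= i.+1)%N) U j)%VS.

Definition tridiagonal_pair A As : Prop :=
  [/\ lfun_diagonalizable A /\ lfun_diagonalizable As,
      exists (d : nat) (U : 'I_d.+1 -> {vspace V}), standard_ordering A As U,
      exists (delta : nat) (Us : 'I_delta.+1 -> {vspace V}),
        standard_ordering As A Us &
      ~ (exists W : {vspace V}, [/\ W != 0%VS, W != fullv,
           (A @: W <= W)%VS & (As @: W <= W)%VS])].

Definition primitive_idempotent A W (P : 'End(V)) : Prop :=
  [/\ is_eigenspace A W,
      limg P = W,
      {in W, forall v, P v = v} &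
      forall W', is_eigenspace A W' -> W' != W -> {in W', forall v, P v = 0}].

Definition standard_idempotents (d : nat) A B (E : 'I_d.+1 -> 'End(V)) : Prop :=
  exists2 U : 'I_d.+1 -> {vspace V}, standard_ordering A B U &
    forall i, primitive_idempotent A (U i) (E i).

Definition tridiagonal_system (d : nat) A (E : 'I_d.+1 -> 'End(V))
    As (Es : 'I_d.+1 -> 'End(V)) : Prop :=
  [/\ tridiagonal_pair A As,
      standard_idempotents A As E &
      standard_idempotents As A Es].

(* For i < d, [widen_ord (leqnSn d) i] is the index i and [lift ord0 i] is the
   index i + 1, both in 'I_d.+1. *)
Definition raising_map (d : nat) A (Es : 'I_d.+1 -> 'End(V)) : 'End(V) :=
  \sum_(i < d) (Es (lift ord0 i) \o A \o Es (widen_ord (leqnSn d) i))%VF.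

(* The usual index 1 <= i <= d is shifted by one. *)
Definition lowering_map (d : nat) A (Es : 'I_d.+1 -> 'End(V)) : 'End(V) :=
  \sum_(i < d) (Es (widen_ord (leqnSn d) i) \o A \o Es (lift ord0 i))%VF.

(* Each of the next three includes that f restricts to a map from U to W. *)
Definition injective_from_to (f : V -> V) U W : Prop :=
  {in U, forall u, f u \in W} /\ {in U &, injective f}.

Definition surjective_from_to (f : V -> V) U W : Prop :=
  {in U, forall u, f u \in W} /\
  {in W, forall w, exists2 u, u \in U & f u = w}.

Definition bijective_from_to (f : V -> V) U W : Prop :=
  injective_from_to f U W /\ surjective_from_to f U W.

End Tridiagonal.

(* Main.v *)
Require Import Defs.
From mathcomp Require Import all_boot all_algebra.

(* With respect to the flag V*_i = Es_0 V + ... + Es_(i-1) V, the raising map is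
   the degree one part of A, so modulo V*_(i+m) the power R^m agrees on Es_i V
   with any product of m factors A - theta I.  Irreducibility gives the split
   decomposition: the spaces (Es_0 V + ... + Es_i V) :&: (E_i V + ... + E_d V)
   span V, and (Es_0 V + ... + Es_(k-1) V) :&: (E_k V + ... + E_d V) = 0.
   Lift v in Es_i V to u in the i-th split space.  If R^(j-i) v = 0 then
   (A - th_(j-1)) ... (A - th_i) u lies in V*_j :&: (E_j V + ... + E_d V) = 0, so
   u is in E_i V + ... + E_(j-1) V; if i + j <= d, the second intersection
   property for the reversed ordering of the E_i forces u = 0.  Reversing the
   Es_i exchanges R and L, which makes the dimensions of Es_i V and Es_(d-i) V
   equal; so R^(d-2i) is bijective, and surjectivity for i + j >= d follows by
   factoring such a bijection through R^(j-i). *)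

Local Open Scope ring_scope.

Section TridiagonalSystems.

Set Implicit Arguments.
Unset Strict Implicit.
Unset Printing Implicit Defensive.

Import GRing.Theory.

Variables (F : fieldType) (V : vectType F) (d : nat).
Implicit Types (A B : 'End(V)) (E Es : 'I_d.+1 -> 'End(V)) (th : nat -> F).

(** * Spectral data of a standard ordering *)

(* The eigenvalue sequence is indexed by [nat]; only [th 0, ..., th d] matter. *)
Record standard_spectrum A B E th : Prop := StandardSpectrum {
  idem_sum : forall v, \sum_i E i v = v;
  idem_mul : forall i j v, E i (E j v) = if i == j then E j v else 0;
  idem_eigen : forall i v, A (E i v) = th i *: E i v;
  eigenvalue_inj : forall i j : 'I_d.+1, th i = th j -> i = j;
  idem_tridiag : forall (i j : 'I_d.+1) v,
    (j.+1 < i)%N || (i.+1 < j)%N -> E j (B (E i v)) = 0;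
  idem_neq0 : forall i, exists v, E i v != 0 }.

Lemma basis_lfun_eq A B (X : seq V) :
  basis_of fullv X -> {in X, A =1 B} -> A =1 B.
Proof.
move=> bX /span_lfunP AB v; apply: AB.
by rewrite (span_basis bX) memvf.
Qed.

Lemma eigenvectorP A (a : F) v :
  reflect (A v = a *: v) (v \in passmx.leigenspace A a).
Proof.
rewrite memv_ker !lfun_simp subr_eq0; exact: eqP.
Qed.

(** Each vector of an eigenbasis of [A] lies in a single [U i], where the [E i] add up to the
    identity; linearity extends this to $V$. *)
Lemma standard_idempotents_spectrum A B E :
  lfun_diagonalizable A -> standard_idempotents A B E ->
  exists th, standard_spectrum A B E th.
Proof.
move=> [X bX eigX] [U [[injU eigU] triU] idE].
have EU i v : E i v \in U i.
  by have [_ <- _ _] := idE i; apply: memv_img; rewrite memvf.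
have Eid i v : v \in U i -> E i v = v by have [_ _ + _] := idE i; apply.
have E0 i j v : i != j -> v \in U j -> E i v = 0.
  move=> ij; have [_ _ _ E0] := idE i; apply: E0.
    by apply/eigU; exists j.
  by apply: contra_neq ij => /injU.
(* The boolean body lets [xchoose] pick an eigenvalue for each index. *)
have eigUi (i : 'I_d.+1) :
    exists a, passmx.leigenvalue A a && (U i == passmx.leigenspace A a).
  have [[a ea Ua] _ _ _] := idE i; exists a; by rewrite ea Ua eqxx.
pose th0 i := xchoose (eigUi i).
have th0P i : U i = passmx.leigenspace A (th0 i).
  by have /andP[_ /eqP] := xchooseP (eigUi i).
have Un0 i : U i != 0%VS.
  by rewrite th0P; have /andP[] := xchooseP (eigUi i).
exists (fun n => th0 (inord n)); split.
- move=> v; rewrite -sum_lfunE -[RHS]id_lfunE.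
  apply: (basis_lfun_eq bX) => x xX; rewrite id_lfunE sum_lfunE.
  have [a Ax] := eigX x xX.
  have x0 : x != 0.
    apply: contraTneq xX => ->; apply/negP => zX.
    by have := free_not0 (basis_free bX) zX; rewrite eqxx.
  have [|i Ui] := (eigU (passmx.leigenspace A a)).1.
    exists a => //; apply: contra_neq x0 => /= e0.
    by apply/eqP; rewrite -memv0 -e0; apply/eigenvectorP.
  have xU : x \in U i by rewrite -Ui; apply/eigenvectorP.
  rewrite (bigD1 i) //= Eid // big1 ?addr0 // => j ji.
  exact: E0 ji xU.
- move=> i j v; case: eqVneq => [->|ij]; first exact: Eid.
  exact: E0 ij (EU _ _).
- by move=> i v; apply/eigenvectorP; rewrite inord_val -th0P.
- by move=> i j; rewrite !inord_val => e; apply: injU; rewrite !th0P e.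
- move=> i j v far.
  have /memv_sumP[u uU ->] := subvP (triU i) _ (memv_img B (EU i v)).
  rewrite linear_sum big1 // => k /andP[ik ki].
  apply: E0 (uU _ _); last by rewrite ik.
  by apply: contraTneq far => ->; rewrite negb_or -!leqNgt ki ik.
- move=> i; exists (vpick (U i)).
  by rewrite Eid ?memv_pick // vpick0.
Qed.

(** Applied to [Es], this symmetry exchanges $R$ and $L$; applied to [E], it supplies the second
    intersection property. *)
Lemma standard_spectrum_rev A B E th :
  standard_spectrum A B E th ->
  standard_spectrum A B (E \o @rev_ord _) (fun n => th (d - n)%N).
Proof.
have revE (i : 'I_d.+1) : (d - i)%N = rev_ord i by rewrite /= subSS.
case=> sE mE eE iE tE nE; split => /=.
- by move=> v; rewrite -[RHS]sE [RHS](reindex_inj rev_ord_inj).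
- by move=> i j v; rewrite mE (inj_eq rev_ord_inj).
- by move=> i v; rewrite revE.
- by move=> i j; rewrite !revE => /iE /rev_ord_inj.
- have flip (i j : 'I_d.+1) : (i.+1 < j)%N -> ((rev_ord j).+1 < rev_ord i)%N.
    move=> ij; have jd : (j <= d)%N by rewrite -ltnS.
    by rewrite /= !subSS ltn_subRL addnS -addSn -[X in (_ < X)%N](subnKC jd) ltn_add2r.
  by move=> i j v /orP[] /flip far; apply: tE; rewrite far ?orbT.
- by move=> i; have [v] := nE (rev_ord i); exists v.
Qed.

(** * The two flags of an ordering *)

(** For idempotents as in [standard_spectrum], [below] and [above] are the spans of the $E_iV$ with
    $i<k$ and with $i\ge k$. Written as kernels, membership is a vanishing of components. *)
Definition below E k : {vspace V} := lker (\sum_(i : 'I_d.+1 | (k <= i)%N) E i).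
Definition above E k : {vspace V} := lker (\sum_(i : 'I_d.+1 | (i < k)%N) E i).

Section Flags.

Variables (A B : 'End(V)) (E : 'I_d.+1 -> 'End(V)) (th : nat -> F).
Hypothesis spE : standard_spectrum A B E th.

Lemma lker_idem_sumP (P : pred 'I_d.+1) v :
  reflect (forall i, P i -> E i v = 0) (v \in lker (\sum_(i | P i) E i)).
Proof.
rewrite memv_ker sum_lfunE; apply: (iffP eqP) => [s0 i Pi|E0].
  have := congr1 (E i) s0; rewrite linear0 linear_sum (bigD1 i) //=.
  rewrite (idem_mul spE) eqxx big1 ?addr0 // => j /andP[_ ji].
  by rewrite (idem_mul spE) eq_sym (negPf ji).
by rewrite big1.
Qed.

Lemma belowP k v :
  reflect (forall i : 'I_d.+1, (k <= i)%N -> E i v = 0) (v \in below E k).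
Proof. exact: lker_idem_sumP. Qed.

Lemma aboveP k v :
  reflect (forall i : 'I_d.+1, (i < k)%N -> E i v = 0) (v \in above E k).
Proof. exact: lker_idem_sumP. Qed.

Lemma idem_all0 v : (forall i, E i v = 0) -> v = 0.
Proof. by move=> E0; rewrite -[v](idem_sum spE) big1. Qed.

Lemma idem_comm i v : E i (A v) = th i *: E i v.
Proof.
rewrite -{1}[v](idem_sum spE) linear_sum linear_sum (bigD1 i) //=.
rewrite (idem_eigen spE) linearZ /= (idem_mul spE) eqxx big1 ?addr0 // => j ji.
by rewrite (idem_eigen spE) linearZ /= (idem_mul spE) eq_sym (negPf ji) scaler0.
Qed.

Lemma below0 v : v \in below E 0 -> v = 0.
Proof. by move/belowP=> E0; apply: idem_all0 => i; apply: E0. Qed.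

Lemma above_last k v : (d < k)%N -> v \in above E k -> v = 0.
Proof.
move=> dk /aboveP E0; apply: idem_all0 => i; apply: E0.
exact: leq_trans (ltn_ord i) dk.
Qed.

Lemma above0 v : v \in above E 0.
Proof. exact/aboveP. Qed.

Lemma below_le k l v : (k <= l)%N -> v \in below E k -> v \in below E l.
Proof.
by move=> kl /belowP E0; apply/belowP=> i li; apply: E0; apply: leq_trans li.
Qed.

Lemma above_le k l v : (k <= l)%N -> v \in above E l -> v \in above E k.
Proof.
by move=> kl /aboveP E0; apply/aboveP=> i ik; apply: E0; apply: leq_trans kl.
Qed.

(** $A-\theta_k$ kills the top component and scales the others. *)
Lemma eigen_below k v : v \in below E k.+1 -> A v - th k *: v \in below E k.
Proof.
move=> /belowP E0; apply/belowP => i ki.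
rewrite linearB linearZ /= idem_comm -scalerBl.
have [ik|ki'] := leqP i k; last by rewrite E0 ?scaler0.
have -> : k = i by apply/eqP; rewrite eqn_leq ki.
by rewrite subrr scale0r.
Qed.

Lemma eigen_above k v : v \in above E k -> A v - th k *: v \in above E k.+1.
Proof.
move=> /aboveP E0; apply/aboveP => i ik.
rewrite linearB linearZ /= idem_comm -scalerBl.
have [ki|ki] := leqP k i; last by rewrite E0 ?scaler0.
have -> : k = i by apply/eqP; rewrite eqn_leq ki.
by rewrite subrr scale0r.
Qed.

Lemma tridiag_below k v : v \in below E k -> B v \in below E k.+1.
Proof.
move=> /belowP E0; apply/belowP => i ki.
rewrite -[v](idem_sum spE) linear_sum linear_sum big1 //= => j _.
have [kj|jk] := leqP k j; first by rewrite E0 // !linear0.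
by apply: (idem_tridiag spE); rewrite (leq_ltn_trans jk ki) orbT.
Qed.

Lemma tridiag_above k v : v \in above E k.+1 -> B v \in above E k.
Proof.
move=> /aboveP E0; apply/aboveP => i ik.
rewrite -[v](idem_sum spE) linear_sum linear_sum big1 //= => j _.
have [jk|kj] := leqP j k; first by rewrite E0 // !linear0.
by apply: (idem_tridiag spE); rewrite (leq_ltn_trans ik kj).
Qed.

Lemma idem_below i v : E i v \in below E i.+1.
Proof.
apply/belowP => j ij; rewrite (idem_mul spE).
by case: eqVneq ij => // ->; rewrite ltnn.
Qed.

Lemma idem_sub_below (i : 'I_d.+1) v :
  v \in below E i.+1 -> E i v - v \in below E i.
Proof.
move=> bv; apply/belowP => j ij; rewrite linearB /= (idem_mul spE).
case: eqVneq => [->|ji]; first by rewrite subrr.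
rewrite (belowP _ _ bv) ?subr0 // ltn_neqAle ij andbT.
by rewrite eq_sym -(inj_eq val_inj) in ji.
Qed.

Lemma mem_limg_idem i v : v \in limg (E i) -> E i v = v.
Proof. by case/memv_imgP=> u _ ->; rewrite (idem_mul spE) eqxx. Qed.

End Flags.

(** * Split decomposition *)

Definition irreducible_pair A B : Prop :=
  forall W : {vspace V}, (A @: W <= W)%VS -> (B @: W <= W)%VS ->
    W = 0%VS \/ W = fullv.

(** For $a=1$ the summands are the split spaces, for $a=0$ the intersections to be shown zero; one
    invariance argument covers both. *)
Definition split_sum E Es a : {vspace V} :=
  (\sum_(k < d.+1) (below Es (k + a) :&: above E k))%VS.

Section Split.

Variables (A As : 'End(V)) (E Es : 'I_d.+1 -> 'End(V)) (th ths : nat -> F).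
Hypothesis spE : standard_spectrum A As E th.
Hypothesis spEs : standard_spectrum As A Es ths.
Hypothesis irr : irreducible_pair A As.

Lemma memv_split_sum a k v :
  v \in below Es (k + a) -> v \in above E k -> v \in split_sum E Es a.
Proof.
move=> bv av; have [kd|dk] := ltnP k d.+1.
  apply: (subvP (sumv_sup (Ordinal kd) _ (subvv _))) => //.
  by rewrite memv_cap bv.
by rewrite (above_last spE dk av) mem0v.
Qed.

Lemma split_sum_stable (f : 'End(V)) a (W : {vspace V}) :
  (forall k v, v \in below Es (k + a) -> v \in above E k -> f v \in W) ->
  (f @: split_sum E Es a <= W)%VS.
Proof.
move=> fW; rewrite limg_sum; apply/subv_sumP => k _.
apply/subvP => _ /memv_imgP[v + ->]; rewrite memv_cap => /andP[bv av].
exact: fW bv av.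
Qed.

(** On the $k$-th summand, $A-\theta_k$ leads to the next one and, for $k\ge1$,
    $A^*-\theta^*_{k+a-1}$ to the previous one. The sum is thus invariant and irreducibility
    applies. *)
Lemma split_sum_0_or_full a : (a <= 1)%N ->
  split_sum E Es a = 0%VS \/ split_sum E Es a = fullv.
Proof.
move=> a1; apply: irr; apply: split_sum_stable => k v bv av.
  rewrite -[A v](subrK (th k *: v)) memvD ?memvZ //; last first.
    exact: memv_split_sum bv av.
  apply: (@memv_split_sum _ k.+1); last exact: (eigen_above spE).
  rewrite addSn memvB ?(tridiag_below spEs) ?memvZ //.
  exact: (below_le spEs) (leqnSn _) bv.
(* There is no summand before $k=0$, but $a\le1$ puts $v$ in $E^*_0V$, where $A^*$ is a scalar. *)
case: k => [|k] in bv av *.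
  rewrite (_ : As v = ths 0 *: v) ?memvZ //.
    exact: memv_split_sum bv av.
  apply/eqP; rewrite -subr_eq0; apply/eqP; apply: (below0 spEs).
  apply: (eigen_below spEs); exact: (below_le spEs) a1 bv.
rewrite -[As v](subrK (ths (k + a)%N *: v)) memvD ?memvZ //; last first.
  exact: memv_split_sum bv av.
apply: (@memv_split_sum _ k).
  exact: (eigen_below spEs).
rewrite memvB ?(tridiag_above spE) ?memvZ //.
exact: (above_le spE) (leqnSn _) av.
Qed.

(** For $a=0$ every summand lies in [below Es d], which is proper because $E^*_dV\ne0$; hence the
    sum is zero. *)
Lemma below_above_eq0 k v : v \in below Es k -> v \in above E k -> v = 0.
Proof.
move=> bv av; have [s0|sfull] := @split_sum_0_or_full 0%N isT.
  have bv0 : v \in below Es (k + 0) by rewrite addn0.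
  have := memv_split_sum bv0 av; rewrite s0 memv0; exact/eqP.
have [w] := idem_neq0 spEs ord_max; have := memvf w; rewrite -sfull.
have: (split_sum E Es 0 <= below Es d)%VS.
  apply/subv_sumP => i _; apply/subvP => u; rewrite memv_cap => /andP[+ _].
  by apply: (below_le spEs); rewrite addn0 -ltnS.
move/subvP=> sub /sub /(belowP spEs) -> //.
by rewrite eqxx.
Qed.

(** The summand $k=0$ contains $E^*_0V\ne0$. *)
Lemma split_sum1 : split_sum E Es 1 = fullv.
Proof.
have [s0|//] := @split_sum_0_or_full 1%N isT.
have [w] := idem_neq0 spEs ord0.
suff: Es ord0 w \in split_sum E Es 1 by rewrite s0 memv0 => ->.
apply: (@memv_split_sum _ 0); last exact: (above0 spE).
exact: (idem_below spEs ord0).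
Qed.

(** Expand $v$ along the split sum: terms of index below $i$ have no $E^*_i$ component and those
    above $i$ add up to zero, so the $i$-th term is a lift. *)
Lemma split_lift (i : 'I_d.+1) v : v \in limg (Es i) ->
  exists u, [/\ u \in below Es i.+1, u \in above E i & Es i u = v].
Proof.
move=> vi; have Ev := mem_limg_idem spEs vi.
have /memv_sumP[u uP vE] : v \in split_sum E Es 1 by rewrite split_sum1 memvf.
have ub k : u k \in below Es k.+1.
  by have := uP k isT; rewrite memv_cap addn1 => /andP[].
have ua k : u k \in above E k.
  by have := uP k isT; rewrite memv_cap => /andP[].
(* Both $v$ and the terms with $k\le i$ lie in [below Es i.+1], hence so does the tail, which also
   lies in [above E i.+1]. *)
have tail0 : \sum_(k : 'I_d.+1 | (i < k)%N) u k = 0.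
  apply: (@below_above_eq0 i.+1).
    have -> : \sum_(k : 'I_d.+1 | (i < k)%N) u k = v - \sum_(k : 'I_d.+1 | (k <= i)%N) u k.
      rewrite vE [X in X - _](bigID (fun k : 'I_d.+1 => (k <= i)%N)) /=.
      by rewrite addrAC subrr add0r; apply: eq_bigl => k; rewrite ltnNge.
    rewrite memvB //.
      by rewrite -Ev; apply: (idem_below spEs).
    by apply: rpred_sum => k ki; apply: (below_le spEs) (ub k).
  by apply: rpred_sum => k ki; apply: (above_le spE) (ua k).
exists (u i); split=> //.
rewrite -[RHS]Ev vE linear_sum (bigD1 i) //=.
rewrite [X in _ + X](bigID (fun k : 'I_d.+1 => (i < k)%N)) /=.
rewrite -linear_sum (eq_bigl (fun k : 'I_d.+1 => (i < k)%N) u) => [|k]; last first.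
  by case: eqVneq => // ->; rewrite ltnn.
rewrite tail0 linear0 add0r big1 ?addr0 // => k /andP[ki].
rewrite -leqNgt leq_eqVlt => /predU1P[/val_inj e|lt].
  by rewrite e eqxx in ki.
exact: (belowP spEs _ _ (ub k)).
Qed.

End Split.

(** * Powers of the raising map *)

Lemma raising_mapE A B Es ths (i j : 'I_d.+1) v :
  standard_spectrum B A Es ths -> j = i.+1 :> nat ->
  v \in limg (Es i) -> raising_map A Es v = Es j (A v).
Proof.
move=> spEs ji vi; have Ev := mem_limg_idem spEs vi.
have id : (i < d)%N by rewrite -ltnS -ji.
have wi : widen_ord (leqnSn d) (Ordinal id) = i by apply: val_inj.
have lj : lift ord0 (Ordinal id) = j by apply: val_inj; rewrite /= ji.
rewrite /raising_map sum_lfunE (bigD1 (Ordinal id)) //= !comp_lfunE wi lj Ev.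
rewrite big1 ?addr0 // => k ki; rewrite !comp_lfunE -Ev (idem_mul spEs).
case: eqVneq => [e|_]; last by rewrite !linear0.
by case/eqP: ki; apply: val_inj; rewrite /= -e.
Qed.

Lemma raising_map_rev A Es :
  raising_map A (Es \o @rev_ord _) = lowering_map A Es.
Proof.
rewrite /raising_map (reindex_inj rev_ord_inj); apply: eq_bigr => i _ /=.
have id : (i < d)%N := ltn_ord i.
congr (Es _ \o _ \o Es _)%VF; apply: val_inj => /=.
  by rewrite /bump leq0n add1n subSS subnSK // subKn // ltnW.
by rewrite /bump leq0n add1n subSS subKn.
Qed.

(** [iter] gives a bare function, while kernels, images and dimensions are taken of linear maps. *)
Lemma iter_lfun A m : exists f : 'End(V), f =1 iter m A.
Proof.
elim: m => [|m [f fE]]; first by exists \1%VF => v; rewrite id_lfunE.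
by exists (A \o f)%VF => v; rewrite comp_lfunE fE.
Qed.

Lemma iter_raising_limg A B Es ths (i j : 'I_d.+1) m v :
  standard_spectrum B A Es ths -> j = (i + m)%N :> nat ->
  v \in limg (Es i) -> iter m (raising_map A Es) v \in limg (Es j).
Proof.
move=> spEs; elim: m j => [|m IHm] j ji vi.
  by rewrite (_ : j = i) //; apply: ord_inj; rewrite ji addn0.
have kd : (i + m < d.+1)%N by apply: leq_trans (ltn_ord j); rewrite ji addnS ltnW.
have wk := IHm (Ordinal kd) erefl vi.
have jk : j = (Ordinal kd).+1 :> nat by rewrite ji addnS.
by rewrite iterS (raising_mapE spEs jk wk) memv_img ?memvf.
Qed.

(** * Injectivity for $i+j\le d$ *)

Section RaisingBijective.

Variables (A As : 'End(V)) (E Es : 'I_d.+1 -> 'End(V)) (th ths : nat -> F).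
Hypothesis spE : standard_spectrum A As E th.
Hypothesis spEs : standard_spectrum As A Es ths.
Hypothesis irr : irreducible_pair A As.

(* The witness is (A - th (i + m - 1)) ... (A - th i) u: modulo the span of
   the lower Es-eigenspaces, R acts on Es-components as A minus any scalar. *)
Lemma iter_raising_approx (i : 'I_d.+1) m u : (i + m <= d)%N ->
  u \in below Es i.+1 -> u \in above E i ->
  exists y, [/\ iter m (raising_map A Es) (Es i u) - y \in below Es (i + m),
    y \in above E (i + m) &
    forall h : 'I_d.+1, (i + m <= h)%N -> E h y = 0 -> E h u = 0].
Proof.
move=> imd bu au; elim: m imd => [|m IHm] imd.
  exists u; rewrite addn0; split=> //; exact: (idem_sub_below spEs).
rewrite addnS in imd *.
have [y [bw ay Ey]] := IHm (ltnW imd).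
exists (A y - th (i + m)%N *: y); split; last 1 first.
- move=> h imh; rewrite linearB linearZ /= (idem_comm spE) -scalerBl.
  (* The new factor scales $E_hy$ by $\theta_h-\theta_{i+m}$, nonzero since $h>i+m$. *)
  move/eqP; rewrite scaler_eq0 subr_eq0 => /orP[/eqP e|/eqP e]; last first.
    by apply: Ey e; apply: ltnW.
  have imd' : (i + m < d.+1)%N by apply: leqW.
  have /(congr1 val) hE := eigenvalue_inj spE (e : th h = th (Ordinal imd')).
  by rewrite hE /= ltnn in imh.
- have kd : (i + m < d.+1)%N by apply: leqW.
  set w := iter m _ _ in bw *.
  have wk : w \in limg (Es (Ordinal kd)).
    by apply: (iter_raising_limg spEs) => //; rewrite memv_img ?memvf.
  rewrite iterS -/w (raising_mapE (j := Ordinal (imd : (i + m).+1 < d.+1)%N)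
    spEs _ wk) //=.
  set j := Ordinal _.
  (* Each summand lies in [below Es (i + m).+1]: the first loses the top component of $Aw$, the
     second starts one level lower, and the third uses $y=w-(w-y)$. *)
  have -> : Es j (A w) - (A y - th (i + m)%N *: y) =
      (Es j (A w) - A w) + A (w - y) + th (i + m)%N *: y.
    by rewrite [A (w - y)]linearB opprB !addrA subrK addrAC.
  have bwk : w \in below Es (i + m).+1.
    rewrite -(mem_limg_idem spEs wk); exact: (idem_below spEs (Ordinal kd)).
  have bAw := tridiag_below spEs bwk.
  apply: rpredD; first apply: rpredD.
  + exact: (idem_sub_below spEs (i := j)).
  + exact: (tridiag_below spEs).
  rewrite memvZ // -[y](subKr w) rpredB //.
  exact: (below_le spEs) (leqnSn _) bw.
- exact: (eigen_above spE).
Qed.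

Lemma iter_raising_eq0 (i j : 'I_d.+1) v : (i <= j)%N -> (i + j <= d)%N ->
  v \in limg (Es i) -> iter (j - i) (raising_map A Es) v = 0 -> v = 0.
Proof.
move=> ij ijd vi Rv0.
have [u [bu au uv]] := split_lift spE spEs irr vi.
have imd : (i + (j - i) <= d)%N by rewrite subnKC // -ltnS.
have [y [+ ay Ey]] := iter_raising_approx imd bu au.
rewrite uv Rv0 sub0r rpredN subnKC // in ay Ey * => by_.
have y0 : y = 0 := below_above_eq0 spE spEs irr by_ ay.
have u0 : u = 0; last by rewrite -uv u0 linear0.
(* For the reversed [E], what remains is $E_hu=0$ for $h\ge d-i$. As $d-i\ge j$, this follows from
   $y=0$. *)
apply: (below_above_eq0 (standard_spectrum_rev spE) spEs irr bu).
apply/(aboveP (standard_spectrum_rev spE)) => h hi /=.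
apply: Ey; last by rewrite y0 linear0.
rewrite /= subSS leq_subRL; last by rewrite -ltnS.
by apply: leq_trans ijd; rewrite leq_add2r -ltnS.
Qed.

Lemma iter_raising_injective (i j : 'I_d.+1) : (i <= j)%N -> (i + j <= d)%N ->
  injective_from_to (iter (j - i) (raising_map A Es))
    (limg (Es i)) (limg (Es j)).
Proof.
move=> ij ijd; split=> [v vi|u v ui vi].
  by apply: (iter_raising_limg spEs) vi; rewrite subnKC.
have [f fE] := iter_lfun (raising_map A Es) (j - i).
rewrite -!fE => /eqP; rewrite -subr_eq0 -linearB /= fE => /eqP uv0.
apply/eqP; rewrite -subr_eq0; apply/eqP.
exact: iter_raising_eq0 ij ijd (rpredB ui vi) uv0.
Qed.

Lemma dim_iter_raising (f : 'End(V)) (i j : 'I_d.+1) :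
  f =1 iter (j - i) (raising_map A Es) -> (i <= j)%N -> (i + j <= d)%N ->
  \dim (f @: limg (Es i)) = \dim (limg (Es i)).
Proof.
move=> fE ij ijd; apply: limg_dim_eq.
apply/eqP; rewrite -subv0; apply/subvP => v; rewrite memv_cap memv_ker memv0.
rewrite fE => /andP[vi /eqP Rv0]; apply/eqP.
exact: iter_raising_eq0 ij ijd vi Rv0.
Qed.

Lemma leq_dim_idem (i j : 'I_d.+1) : (i <= j)%N -> (i + j <= d)%N ->
  (\dim (limg (Es i)) <= \dim (limg (Es j)))%N.
Proof.
move=> ij ijd; have [f fE] := iter_lfun (raising_map A Es) (j - i).
rewrite -(dim_iter_raising fE ij ijd).
apply/dimvS/subvP => _ /memv_imgP[v vi ->]; rewrite fE.
by have [-> ] := iter_raising_injective ij ijd.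
Qed.

End RaisingBijective.

(** * Surjectivity for $i+j\ge d$ *)

Section RaisingTheorem.

Variables (A As : 'End(V)) (E Es : 'I_d.+1 -> 'End(V)) (th ths : nat -> F).
Hypothesis spE : standard_spectrum A As E th.
Hypothesis spEs : standard_spectrum As A Es ths.
Hypothesis irr : irreducible_pair A As.

(* The reverse inequality of dimensions comes from the reversed ordering of the
   Es, which exchanges the raising and lowering maps. *)
Lemma iter_raising_surjective_sym (i j : 'I_d.+1) :
  (i <= j)%N -> (i + j = d)%N ->
  surjective_from_to (iter (j - i) (raising_map A Es))
    (limg (Es i)) (limg (Es j)).
Proof.
move=> ij ijd; have ijd' : (i + j <= d)%N by rewrite ijd.
have [Rij _] := iter_raising_injective spE spEs irr ij ijd'.
split=> // w wj.
have [f fE] := iter_lfun (raising_map A Es) (j - i).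
have fij : (f @: limg (Es i) == limg (Es j))%VS.
  rewrite eqEdim; apply/andP; split.
    by apply/subvP => _ /memv_imgP[v vi ->]; rewrite fE Rij.
  rewrite (dim_iter_raising spE spEs irr fE ij ijd').
  (* With [Es] reversed, $i$ and $j=d-i$ trade places, giving $\dim E^*_jV\le\dim E^*_iV$. *)
  have := leq_dim_idem spE (standard_spectrum_rev spEs) irr ij ijd' => /=.
  have -> : rev_ord i = j by apply: val_inj; rewrite /= subSS -[X in (X - _)%N]ijd addKn.
  by have -> : rev_ord j = i by apply: val_inj; rewrite /= subSS -[X in (X - _)%N]ijd addnK.
by move: wj; rewrite -(eqP fij) => /memv_imgP[v vi ->]; exists v; rewrite ?fE.
Qed.

Lemma iter_raising_theorem (i j : 'I_d.+1) : (i <= j)%N ->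
  let R := raising_map A Es in
  [/\ (i + j <= d)%N ->
        injective_from_to (iter (j - i) R) (limg (Es i)) (limg (Es j)),
      (i + j = d)%N ->
        bijective_from_to (iter (j - i) R) (limg (Es i)) (limg (Es j)) &
      (d <= i + j)%N ->
        surjective_from_to (iter (j - i) R) (limg (Es i)) (limg (Es j))].
Proof.
move=> ij R; split=> ijd.
- exact: (iter_raising_injective spE spEs irr).
- split; last exact: iter_raising_surjective_sym.
  by apply: (iter_raising_injective spE spEs irr); rewrite ?ijd.
split=> [v vi|w wj].
  by apply: (iter_raising_limg spEs) vi; rewrite subnKC.
have jd : (j <= d)%N by rewrite -ltnS.
(* Since $d-j\le i\le j$, the surjection $R^{j-(d-j)}$ from $E^*_{d-j}V$ onto $E^*_jV$ factors
   through $E^*_iV$. *)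
have ki : (rev_ord j <= i)%N by rewrite /= subSS leq_subLR addnC.
have kjd : (rev_ord j + j = d)%N by rewrite /= subSS subnK.
have [_ sur] := iter_raising_surjective_sym (leq_trans ki ij) kjd.
have [u uk <-] := sur w wj; exists (iter (i - rev_ord j) R u).
  by apply: (iter_raising_limg spEs) uk; rewrite subnKC.
by rewrite -iterD addnBA // subnK.
Qed.

End RaisingTheorem.

(** * Irreducibility and transfer to the lowering map *)

Lemma tridiagonal_pair_irreducible A B :
  tridiagonal_pair A B -> irreducible_pair A B.
Proof.
move=> [_ _ _ irr] W AW BW.
have [|W0] := eqVneq W 0%VS; first by left.
have [|WV] := eqVneq W fullv; first by right.
by case: irr; exists W.
Qed.

End TridiagonalSystems.

Theorem theorem10p1 (F : fieldType) (V : vectType F)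
    (hV : (fullv : {vspace V}) <> 0%VS)
    (d : nat) (hd : (1 <= d)%N)
    (A As : 'End(V)) (E Es : 'I_d.+1 -> 'End(V))
    (hPhi : tridiagonal_system A E As Es)
    (i j : 'I_d.+1) (hij : (i <= j)%N) :
  let R := raising_map A Es in
  let L := lowering_map A Es in
  [/\ (i + j <= d)%N ->
        injective_from_to (iter (j - i) R) (limg (Es i)) (limg (Es j)),
      (i + j = d)%N ->
        bijective_from_to (iter (j - i) R) (limg (Es i)) (limg (Es j)) &
      (d <= i + j)%N ->
        surjective_from_to (iter (j - i) R) (limg (Es i)) (limg (Es j))] /\
  [/\ (d <= i + j)%N ->
        injective_from_to (iter (j - i) L) (limg (Es j)) (limg (Es i)),
      (i + j = d)%N ->
        bijective_from_to (iter (j - i) L) (limg (Es j)) (limg (Es i)) &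
      (i + j <= d)%N ->
        surjective_from_to (iter (j - i) L) (limg (Es j)) (limg (Es i))].
Proof.
move: hPhi => [pair idE idEs] R L.
have [diagA diagAs] : lfun_diagonalizable A /\ lfun_diagonalizable As.
  by case: pair.
have [th spE] := standard_idempotents_spectrum diagA idE.
have [ths spEs] := standard_idempotents_spectrum diagAs idEs.
have irr := tridiagonal_pair_irreducible pair.
split; first exact (iter_raising_theorem spE spEs irr hij).
have id : (i <= d)%N by rewrite -ltnS.
have jd : (j <= d)%N by rewrite -ltnS.
(* Part (ii) is part (i) for the reversed [Es] at $(d-j,d-i)$: the difference is still $j-i$, while
   the sum becomes $2d-(i+j)$, which flips the inequalities. *)
have rij : (rev_ord j <= rev_ord i)%N by rewrite /= !subSS leq_sub2l.
have := iter_raising_theorem spE (standard_spectrum_rev spEs) irr rij.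
rewrite /= raising_map_rev !rev_ordK !subSS -/L.
have -> : (d - i - (d - j) = j - i)%N.
  by rewrite subnAC subKn.
have sumE : (d - j + (d - i) + (i + j) = d + d)%N.
  by rewrite [(i + j)%N]addnC addnACA !subnK.
case=> inj bij sur; split=> ijd; [apply: inj|apply: bij|apply: sur].
- by rewrite -(leq_add2r (i + j)) sumE leq_add2l.
- by apply/eqP; rewrite -(eqn_add2r (i + j)) sumE ijd.
- by rewrite -(leq_add2r (i + j)) sumE leq_add2l.
Qed.
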